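(* Let $\mathbb{K}$ be a field of characteristic zero, let $A\subseteq T$ be Noetherian commutative $\mathbb{K}$-algebras such that $A$ is a direct summand of $T$, and let $\beta:T\to A$ be an $A$-linear splitting of the inclusion. Let $\underline f=f_1,\dots,f_\ell\in A$ and assume that $M^A[\underline f^{\underline s}]$ and $M^T[\underline f^{\underline s}]$ have $D_{A|\mathbb{K}}[\underline s]$- and $D_{T|\mathbb{K}}[\underline s]$-module structures, respectively, compatible with specialization. Then the $D_{A|\mathbb{K}}[\underline s]$-module $M^A[\underline f^{\underline s}]$ is a differential direct summand of the $D_{T|\mathbb{K}}[\underline s]$-module $M^T[\underline f^{\underline s}]$, with differential splitting $$\Theta=M^A[\underline f^{\underline s}]\otimes_A\beta:\ M^T[\underline f^{\underline s}]\to M^A[\underline f^{\underline s}].$$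
   Context: For a commutative $\mathbb{K}$-algebra $B$, $D_{B|\mathbb{K}}$ is Grothendieck's ring of $\mathbb{K}$-linear differential operators; modules are left modules with action $\bullet$. For $f_1,\dots,f_\ell\in B$ and indeterminates $\underline s=s_1,\dots,s_\ell$, $M^B[\underline f^{\underline s}]=B_{f_1\cdots f_\ell}[\underline s]\,f_1^{s_1}\cdots f_\ell^{s_\ell}$ is the free rank-one $B_{f_1\cdots f_\ell}[\underline s]$-module on a formal symbol. For $t\in\mathbb{Z}^\ell$, $\varphi_t(h(\underline s)f_1^{s_1}\cdots f_\ell^{s_\ell})=h(t)f_1^{t_1}\cdots f_\ell^{t_\ell}\in B_{f_1\cdots f_\ell}$. A $D_{B|\mathbb{K}}[\underline s]$-module structure on $M^B[\underline f^{\underline s}]$ is compatible with specialization if $\varphi_t(\delta\bullet v)=\delta(t)\bullet\varphi_t(v)$ for all $v$, $\delta\in D_{B|\mathbb{K}}[\underline s]$, $t\in\mathbb{Z}^\ell$ (where $B_{f_1\cdots f_\ell}$ has its usual $D_{B|\mathbb{K}}$-structure by unique extension of operators to the localization); such a structure is unique if it exists. Here $M^T[\underline f^{\underline s}]$ is identified with $M^A[\underline f^{\underline s}]\otimes_AT$. For $\zeta\in D_{T|\mathbb{K}}$, $\beta\circ\zeta|_A\in D_{A|\mathbb{K}}$; for $\delta\in D_{T|\mathbb{K}}[\underline s]$, $\beta\circ\delta|_A\in D_{A|\mathbb{K}}[\underline s]$ is obtained coefficientwise. A $D_{A|\mathbb{K}}[\underline s]$-module $M$ is a differential direct summand of a $D_{T|\mathbb{K}}[\underline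 s]$-module $N$ if $M\subseteq N$ and there is an $A$-linear splitting $\Theta:N\to M$ of the inclusion (a differential splitting) with $\Theta(\delta\bullet v)=(\beta\circ\delta|_A)\bullet v$ for all $\delta\in D_{T|\mathbb{K}}[\underline s]$, $v\in M$. *)

(* Defs.v *)
From HB Require Import structures.
From mathcomp Require Import all_boot all_order all_algebra.
From mathcomp Require Import boolp.
From mathcomp Require Import finmap monalg.
From mathcomp Require Import zify ring.

Set Implicit Arguments.
Unset Strict Implicit.
Unset Printing Implicit Defensive.

Import GRing.Theory.
Local Open Scope ring_scope.
Local Open Scope quotient_scope.

(* Every ideal is finitely generated; a submodule of the regular module [B^o]
   is an ideal, and the classical axioms make [{pred B^o}] range over all
   subsets. *)
Definition noetherian (B : comNzRingType) : Prop :=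
  forall I : {pred B^o}, GRing.submod_closed I ->
  exists (r : nat) (x : 'I_r -> B), forall b : B,
    b \in I <-> exists c : 'I_r -> B, b = \sum_(i < r) c i * x i.

Section DiffOrder.
Variable B : comPzRingType.
Implicit Types (d e : B -> B) (b x : B).

Definition ad d b : B -> B := fun x => d (b * x) - b * d x.

(* Grothendieck's inductive definition: order 0 means B-linear, and order at
   most n.+1 means that all commutators with multiplications have order at
   most n. The K-linearity of operators is required in [is_diffop]. *)
Fixpoint diff_order (n : nat) d : Prop :=
  match n with
  | 0 => forall b x, d (b * x) = b * d x
  | n'.+1 => forall b, diff_order n' (ad d b)
  end.

Lemma eq_diff_order n d e : d =1 e -> diff_order n d -> diff_order n e.
Proof. by move=> /funext ->. Qed.

Lemma diff_orderS n d : diff_order n d -> diff_order n.+1 d.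
Proof.
elim: n d => [|n IH] d /= dP; last by move=> b; apply: IH; apply: dP.
by move=> b c x; rewrite /ad !dP; ring.
Qed.

Lemma diff_orderW n m d : (n <= m)%N -> diff_order n d -> diff_order m d.
Proof.
move=> /subnK <-; elim: (m - n)%N => [|k IH] //= dP.
by apply: (@diff_orderS (k + n)); apply: IH.
Qed.

Lemma diff_order0 n : diff_order n (fun=> 0).
Proof. by apply: (@diff_orderW 0) => // b x; rewrite mulr0. Qed.

Lemma diff_orderD n d e :
  diff_order n d -> diff_order n e -> diff_order n (fun x => d x + e x).
Proof.
elim: n d e => [|n IH] d e /= dP eP b; first by move=> x; rewrite dP eP; ring.
by apply: eq_diff_order (IH _ _ (dP b) (eP b)) => x; rewrite /ad; ring.
Qed.

Lemma diff_order_lmul n d b : diff_order n d -> diff_order n (fun x => b * d x).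
Proof.
elim: n d => [|n IH] d /= dP c; first by move=> x; rewrite dP; ring.
by apply: eq_diff_order (IH _ (dP c)) => x; rewrite /ad; ring.
Qed.

Lemma diff_order_rmul n d b : diff_order n d -> diff_order n (fun x => d (b * x)).
Proof.
elim: n d => [|n IH] d /= dP c; first by move=> x; rewrite !dP; ring.
apply: eq_diff_order (IH _ (dP c)) => x.
by rewrite /ad; congr (d _ - _); ring.
Qed.

Lemma diff_orderN n d : diff_order n d -> diff_order n (fun x => - d x).
Proof.
by move=> /(diff_order_lmul (- 1)); apply: eq_diff_order => x; rewrite mulN1r.
Qed.

Lemma diff_order_comp n m d e : zmod_morphism d ->
  diff_order n d -> diff_order m e -> diff_order (n + m) (d \o e).
Proof.
move: {2}(n + m)%N (leqnn (n + m)) => k.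
elim: k n m d e => [|k IH] n m d e.
  rewrite leqn0 addn_eq0 => /andP[/eqP-> /eqP->] _ dP eP b x /=.
  by rewrite eP dP.
case: n m => [|n] [|m] // nm dA dP eP.
- by move=> b x /=; rewrite eP dP.
- move=> b; rewrite /= in eP.
  apply: eq_diff_order (IH 0 m d _ nm dA dP (eP b)) => x.
  by rewrite /ad /= dA dP.
- rewrite addn0 in nm *; move=> b; rewrite /= in dP.
  have aA : zmod_morphism (ad d b).
    by move=> x y; rewrite /ad mulrBr !dA; ring.
  have nk : (n + 0 <= k)%N by rewrite addn0.
  have := IH n 0 _ e nk aA (dP b) eP; rewrite addn0.
  by apply: eq_diff_order => x; rewrite /ad /= eP.
- move=> b; rewrite /= in dP eP.
  have aA : zmod_morphism (ad d b).
    by move=> x y; rewrite /ad mulrBr !dA; ring.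
  have h1 : (n + m.+1 <= k)%N by [].
  have h2 : (n.+1 + m <= k)%N by rewrite addSn -addnS.
  have /= := diff_orderD (IH n m.+1 _ e h1 aA (dP b) eP) _.
  have := IH n.+1 m d _ h2 dA dP (eP b); rewrite addSn -addnS => H /(_ _ H).
  by apply: eq_diff_order => x; rewrite /ad /= dA; ring.
Qed.
End DiffOrder.

Section DiffOp.
Variables (K : fieldType) (B : comAlgType K).

Definition is_diffop : {pred B -> B} :=
  fun d => `[< linear d /\ exists n, diff_order n d >].

Record diffop := Diffop { diffop_fun :> B -> B; diffopP : diffop_fun \in is_diffop }.

HB.instance Definition _ := [isSub for diffop_fun].
HB.instance Definition _ := [Choice of diffop by <:].

Implicit Types d e : diffop.

Lemma diffop_linear d : linear d.
Proof. by have /asboolP[] := diffopP d. Qed.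

Lemma diffop_order d : exists n, diff_order n d.
Proof. by have /asboolP[] := diffopP d. Qed.

Lemma diffopB d : zmod_morphism d.
Proof. exact: GRing.zmod_morphism_linear (diffop_linear d). Qed.

Lemma diffopD d x y : d (x + y) = d x + d y.
Proof. by have := diffop_linear d 1 x y; rewrite !scale1r. Qed.

Lemma diffop_eq d e : d =1 e -> d = e.
Proof. by move=> /funext de; apply: val_inj. Qed.

Lemma is_diffop0 : (fun=> 0 : B) \in is_diffop.
Proof.
apply/asboolP; split; last by exists 0%N; apply: diff_order0.
by move=> k x y; rewrite scaler0 addr0.
Qed.

Lemma is_diffop1 : id \in is_diffop.
Proof. by apply/asboolP; split=> //; exists 0%N. Qed.

Lemma is_diffop_mul (b : B) : (fun x => b * x) \in is_diffop.
Proof.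
apply/asboolP; split; last by exists 0%N => c x /=; ring.
by move=> k x y; rewrite mulrDr scalerAr.
Qed.

Lemma is_diffopN d : (fun x => - d x) \in is_diffop.
Proof.
apply/asboolP; split.
  by move=> k x y; rewrite diffop_linear opprD scalerN.
by have [n dn] := diffop_order d; exists n; apply: diff_orderN.
Qed.

Lemma is_diffopD d e : (fun x => d x + e x) \in is_diffop.
Proof.
apply/asboolP; split.
  by move=> k x y; rewrite !diffop_linear scalerDr addrACA.
have [n dn] := diffop_order d; have [m em] := diffop_order e.
exists (maxn n m); apply: diff_orderD.
  exact: diff_orderW (leq_maxl _ _) dn.
exact: diff_orderW (leq_maxr _ _) em.
Qed.

Lemma is_diffop_comp d e : (d \o e) \in is_diffop.
Proof.
apply/asboolP; split; first by move=> k x y /=; rewrite !diffop_linear.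
have [n dn] := diffop_order d; have [m em] := diffop_order e.
by exists (n + m)%N; apply: diff_order_comp => //; apply: diffopB.
Qed.

Definition diffop_zero := Diffop is_diffop0.
Definition diffop_one := Diffop is_diffop1.
Definition diffop_opp d := Diffop (is_diffopN d).
Definition diffop_add d e := Diffop (is_diffopD d e).
Definition diffop_comp d e := Diffop (is_diffop_comp d e).

(* The inclusion of B in its ring of differential operators. *)
Definition mul_diffop (b : B) := Diffop (is_diffop_mul b).

Fact diffop_addA : associative diffop_add.
Proof. by move=> d e f; apply: diffop_eq => x /=; rewrite addrA. Qed.
Fact diffop_addC : commutative diffop_add.
Proof. by move=> d e; apply: diffop_eq => x /=; rewrite addrC. Qed.
Fact diffop_add0 : left_id diffop_zero diffop_add.
Proof. by move=> d; apply: diffop_eq => x /=; rewrite add0r. Qed.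
Fact diffop_addN : left_inverse diffop_zero diffop_opp diffop_add.
Proof. by move=> d; apply: diffop_eq => x /=; rewrite addNr. Qed.

HB.instance Definition _ := GRing.isZmodule.Build diffop
  diffop_addA diffop_addC diffop_add0 diffop_addN.

Fact diffop_compA : associative diffop_comp.
Proof. by move=> d e f; apply: diffop_eq. Qed.
Fact diffop_comp1l : left_id diffop_one diffop_comp.
Proof. by move=> d; apply: diffop_eq. Qed.
Fact diffop_comp1r : right_id diffop_one diffop_comp.
Proof. by move=> d; apply: diffop_eq. Qed.
Fact diffop_compDl : left_distributive diffop_comp +%R.
Proof. by move=> d e f; apply: diffop_eq. Qed.
Fact diffop_compDr : right_distributive diffop_comp +%R.
Proof. by move=> d e f; apply: diffop_eq => x /=; rewrite diffopD. Qed.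
Fact diffop_oner_neq0 : diffop_one != 0.
Proof.
apply/eqP => /(congr1 (fun d : diffop => d 1)) /eqP.
by rewrite (oner_eq0 B).
Qed.

HB.instance Definition _ := GRing.Zmodule_isNzRing.Build diffop
  diffop_compA diffop_comp1l diffop_comp1r diffop_compDl diffop_compDr
  diffop_oner_neq0.

End DiffOp.

(* The localization at the powers of g: [frac b n] is b / g^n. It is the zero
   ring when g is nilpotent, hence only a [comPzRingType]. *)
Section Localization.
Variables (B : comNzRingType) (g : B).

Definition loc_rel (x y : B * nat) : bool :=
  `[< exists k, g ^+ k * (g ^+ y.2 * x.1) = g ^+ k * (g ^+ x.2 * y.1) >].

Fact loc_rel_refl : reflexive loc_rel.
Proof. by move=> x; apply/asboolP; exists 0%N. Qed.

Fact loc_rel_sym : symmetric loc_rel.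
Proof. by move=> x y; apply/asboolP/asboolP => -[k e]; exists k. Qed.

Fact loc_rel_trans : transitive loc_rel.
Proof.
move=> y x z /asboolP[k e] /asboolP[k' e']; apply/asboolP.
exists (k + k' + y.2)%N.
have -> : g ^+ (k + k' + y.2) * (g ^+ z.2 * x.1)
        = g ^+ (k' + z.2) * (g ^+ k * (g ^+ y.2 * x.1)).
  by rewrite !exprD; ring.
rewrite e.
have -> : g ^+ (k' + z.2) * (g ^+ k * (g ^+ x.2 * y.1))
        = g ^+ (k + x.2) * (g ^+ k' * (g ^+ z.2 * y.1)).
  by rewrite !exprD; ring.
by rewrite e' !exprD; ring.
Qed.

Canonical loc_equiv := EquivRel loc_rel loc_rel_refl loc_rel_sym loc_rel_trans.

Definition loc := {eq_quot loc_rel}.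
HB.instance Definition _ : EqQuotient _ loc_rel loc := EqQuotient.on loc.
HB.instance Definition _ := Choice.on loc.

Definition frac (b : B) (n : nat) : loc := \pi_loc (b, n).

Lemma eq_frac b n c m :
  frac b n = frac c m <-> exists k, g ^+ k * (g ^+ m * b) = g ^+ k * (g ^+ n * c).
Proof.
split; first by move=> /eqmodP /asboolP.
by move=> h; apply/eqmodP/asboolP.
Qed.

Lemma fracP (x : loc) : frac (repr x).1 (repr x).2 = x.
Proof. by rewrite /frac -surjective_pairing reprK. Qed.

Lemma locW (P : loc -> Prop) : (forall b n, P (frac b n)) -> forall x, P x.
Proof. by move=> h x; rewrite -(fracP x). Qed.

Lemma repr_frac b n :
  exists k, g ^+ k * (g ^+ n * (repr (frac b n)).1)
          = g ^+ k * (g ^+ (repr (frac b n)).2 * b).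
Proof. by apply/eq_frac; rewrite fracP. Qed.

Lemma frac_expand k b n : frac (g ^+ k * b) (k + n) = frac b n.
Proof. by apply/eq_frac; exists 0%N; rewrite !exprD; ring. Qed.

Definition loc_add (x y : loc) :=
  frac (g ^+ (repr y).2 * (repr x).1 + g ^+ (repr x).2 * (repr y).1)
       ((repr x).2 + (repr y).2).
Definition loc_opp (x : loc) := frac (- (repr x).1) (repr x).2.
Definition loc_mul (x y : loc) :=
  frac ((repr x).1 * (repr y).1) ((repr x).2 + (repr y).2).

Lemma loc_addE b n c m :
  loc_add (frac b n) (frac c m) = frac (g ^+ m * b + g ^+ n * c) (n + m).
Proof.
have [k e] := repr_frac b n; have [k' e'] := repr_frac c m.
rewrite /loc_add; move: (repr (frac b n)) (repr (frac c m)) e e' => [b' n'] [c' m'] /= e e'.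
apply/eq_frac; exists (k + k')%N; rewrite !exprD.
transitivity (g ^+ k' * g ^+ m * g ^+ m' * (g ^+ k * (g ^+ n * b'))
            + g ^+ k * g ^+ n * g ^+ n' * (g ^+ k' * (g ^+ m * c'))); first ring.
by rewrite e e'; ring.
Qed.

Lemma loc_oppE b n : loc_opp (frac b n) = frac (- b) n.
Proof.
have [k e] := repr_frac b n.
rewrite /loc_opp; move: (repr _) e => [b' n'] /= e.
by apply/eq_frac; exists k; rewrite !mulrN e.
Qed.

Lemma loc_mulE b n c m : loc_mul (frac b n) (frac c m) = frac (b * c) (n + m).
Proof.
have [k e] := repr_frac b n; have [k' e'] := repr_frac c m.
rewrite /loc_mul; move: (repr (frac b n)) (repr (frac c m)) e e' => [b' n'] [c' m'] /= e e'.
apply/eq_frac; exists (k + k')%N; rewrite !exprD.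
transitivity ((g ^+ k * (g ^+ n * b')) * (g ^+ k' * (g ^+ m * c'))); first ring.
by rewrite e e'; ring.
Qed.

Fact loc_addA : associative loc_add.
Proof.
elim/locW=> b n; elim/locW=> c m; elim/locW=> d p; rewrite !loc_addE.
by rewrite addnA; congr frac; rewrite !exprD; ring.
Qed.
Fact loc_addC : commutative loc_add.
Proof.
by elim/locW=> b n; elim/locW=> c m; rewrite !loc_addE addnC; congr frac; ring.
Qed.
Fact loc_add0 : left_id (frac 0 0) loc_add.
Proof. by elim/locW=> b n; rewrite loc_addE add0n; congr frac; ring. Qed.
Fact loc_addN : left_inverse (frac 0 0) loc_opp loc_add.
Proof.
elim/locW=> b n; rewrite loc_oppE loc_addE; apply/eq_frac; exists 0%N; ring.
Qed.
HB.instance Definition _ := GRing.isZmodule.Build loc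
  loc_addA loc_addC loc_add0 loc_addN.

Fact loc_mulA : associative loc_mul.
Proof.
elim/locW=> b n; elim/locW=> c m; elim/locW=> d p; rewrite !loc_mulE.
by rewrite addnA; congr frac; ring.
Qed.
Fact loc_mulC : commutative loc_mul.
Proof.
by elim/locW=> b n; elim/locW=> c m; rewrite !loc_mulE addnC; congr frac; ring.
Qed.
Fact loc_mul1 : left_id (frac 1 0) loc_mul.
Proof. by elim/locW=> b n; rewrite loc_mulE add0n; congr frac; ring. Qed.
Fact loc_mulDl : left_distributive loc_mul +%R.
Proof.
elim/locW=> b n; elim/locW=> c m; elim/locW=> d p.
rewrite [in LHS]/GRing.add [in RHS]/GRing.add /= !(loc_addE, loc_mulE).
by apply/eq_frac; exists 0%N; rewrite !exprD; ring.
Qed.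
HB.instance Definition _ := GRing.Zmodule_isComPzRing.Build loc
  loc_mulA loc_mulC loc_mul1 loc_mulDl.

Lemma fracD b n c m :
  frac b n + frac c m = frac (g ^+ m * b + g ^+ n * c) (n + m).
Proof. exact: loc_addE. Qed.
Lemma fracDl b c n : frac b n + frac c n = frac (b + c) n.
Proof. by rewrite fracD -mulrDr frac_expand. Qed.
Lemma fracN b n : - frac b n = frac (- b) n.
Proof. exact: loc_oppE. Qed.
Lemma fracM b n c m : frac b n * frac c m = frac (b * c) (n + m).
Proof. exact: loc_mulE. Qed.
Lemma frac0 n : frac 0 n = 0.
Proof. by apply/eq_frac; exists 0%N; ring. Qed.
Lemma frac1 : frac 1 0 = 1.
Proof. by []. Qed.
Lemma frac_unit n : frac (g ^+ n) 0 * frac 1 n = 1.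
Proof. by rewrite fracM -frac1; apply/eq_frac; exists 0%N; rewrite expr0; ring. Qed.
Lemma frac_split b n : frac b n = frac b 0 * frac 1 n.
Proof. by rewrite fracM mulr1. Qed.
Lemma frac_cancel b n : frac (g ^+ n) 0 * frac b n = frac b 0.
Proof. by rewrite (frac_split b) mulrCA frac_unit mulr1. Qed.
Lemma frac_mulI n (x y : loc) : frac (g ^+ n) 0 * x = frac (g ^+ n) 0 * y -> x = y.
Proof.
move=> /(congr1 ( *%R (frac 1 n))).
by rewrite !mulrA ![frac 1 n * _]mulrC frac_unit !mul1r.
Qed.

End Localization.

Section LocAlg.
Variables (K : fieldType) (B : comAlgType K) (g : B).

Definition loc_scale (k : K) (x : loc g) : loc g := frac g (k%:A) 0 * x.

Lemma loc_scaleE k b n : loc_scale k (frac g b n) = frac g (k *: b) n.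
Proof. by rewrite /loc_scale fracM add0n -scalerAl mul1r. Qed.

Fact loc_scaleA a b v : loc_scale a (loc_scale b v) = loc_scale (a * b) v.
Proof. by elim/locW: v => c n; rewrite !loc_scaleE scalerA. Qed.
Fact loc_scale1 : left_id 1 loc_scale.
Proof. by elim/locW=> c n; rewrite loc_scaleE scale1r. Qed.
Fact loc_scaleDr : right_distributive loc_scale +%R.
Proof. by move=> k x y; rewrite /loc_scale mulrDr. Qed.
Fact loc_scaleDl v : {morph loc_scale^~ v : a b / a + b}.
Proof. by move=> a b; rewrite /loc_scale scalerDl -fracDl mulrDl. Qed.
HB.instance Definition _ := GRing.Zmodule_isLmodule.Build K (loc g)
  loc_scaleA loc_scale1 loc_scaleDr loc_scaleDl.

Lemma fracZ k b n : k *: frac g b n = frac g (k *: b) n.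
Proof. exact: loc_scaleE. Qed.

Lemma loc_scalerAr k (x y : loc g) : k *: (x * y) = x * (k *: y).
Proof. by rewrite /GRing.scale /= /loc_scale mulrCA. Qed.

(* d' is a differential operator of the localization extending d. *)
Definition loc_extends (d : B -> B) (d' : loc g -> loc g) : Prop :=
  [/\ linear d', exists n, diff_order n d'
    & forall b, d' (frac g b 0) = frac g (d b) 0].

Lemma loc_ext_uniq0 n (e : loc g -> loc g) : diff_order n e ->
  (forall b, e (frac g b 0) = 0) -> forall x, e x = 0.
Proof.
elim: n e => [|n IH] e /= eP e0; elim/locW=> b m; apply: (@frac_mulI _ _ m).
  by rewrite -eP frac_cancel e0 mulr0.
have h b' : ad e (frac g (g ^+ m) 0) (frac g b' 0) = 0.
  by rewrite /ad fracM !e0 mulr0 subr0.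
have := IH _ (eP (frac g (g ^+ m) 0)) h (frac g b m).
by rewrite /ad frac_cancel e0 sub0r mulr0 => /eqP; rewrite oppr_eq0 => /eqP.
Qed.

Lemma diff_order2 (C : comPzRingType) n m (d e : C -> C) :
  diff_order n d -> diff_order m e ->
  diff_order (maxn n m) d /\ diff_order (maxn n m) e.
Proof.
move=> dn em; split; first exact: diff_orderW (leq_maxl _ _) dn.
exact: diff_orderW (leq_maxr _ _) em.
Qed.

Lemma loc_ext_eq (d1 d2 : loc g -> loc g) n m :
  diff_order n d1 -> diff_order m d2 ->
  (forall b, d1 (frac g b 0) = d2 (frac g b 0)) -> d1 =1 d2.
Proof.
move=> dn em e x; have [o1 o2] := diff_order2 dn em.
apply: subr0_eq; move: x.
apply: (loc_ext_uniq0 (diff_orderD o1 (diff_orderN o2))) => b.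
by rewrite e subrr.
Qed.

Lemma linear_ad (d : B -> B) b : linear d -> linear (ad d b).
Proof.
by move=> dl k x y; rewrite /ad mulrDr -scalerAr !dl mulrDr scalerBr -scalerAr; ring.
Qed.

Lemma loc_ext_exists n (d : B -> B) : linear d -> diff_order n d ->
  exists d' : loc g -> loc g,
   [/\ linear d', diff_order n d' & forall b, d' (frac g b 0) = frac g (d b) 0].
Proof.
elim: n d => [|n IH] d dl /= dP.
  exists (fun x => frac g (d 1) 0 * x); split.
  - by move=> k x y; rewrite mulrDr loc_scalerAr.
  - by move=> b x; rewrite mulrCA.
  - by move=> b; rewrite fracM -[in RHS](mulr1 b) dP mulrC.
have dA x y : d (x + y) = d x + d y by have := dl 1 x y; rewrite !scale1r.
have [E EP] : exists E : B -> loc g -> loc g, forall b,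
    [/\ linear (E b), diff_order n (E b)
      & forall c, E b (frac g c 0) = frac g (ad d b c) 0].
  have h b := IH _ (linear_ad b dl) (dP b).
  by exists (fun b => sval (cid (h b))) => b; case: cid.
have El b k x y : E b (k *: x + y) = k *: E b x + E b y by case: (EP b) => + _ _; apply.
have EA b x y : E b (x + y) = E b x + E b y.
  by have := El b 1 x y; rewrite !scale1r.
have EZ b k x : E b (k *: x) = k *: E b x.
  have E0 : E b 0 = 0 by apply: (@addrI _ (E b 0)); rewrite -EA !addr0.
  by have := El b k x 0; rewrite !addr0 E0 addr0.
have Eo b : diff_order n (E b) by case: (EP b).
have EE b c : E b (frac g c 0) = frac g (ad d b c) 0 by case: (EP b).
have Emul w u x : E (w * u) x = E w (frac g u 0 * x) + frac g w 0 * E u x.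
  apply: (@loc_ext_eq (E (w * u)) (fun x => E w (frac g u 0 * x) + frac g w 0 * E u x) n n) => //.
    by apply: diff_orderD; [apply: diff_order_rmul | apply: diff_order_lmul].
  move=> c; rewrite fracM !EE fracM fracDl; congr frac.
  by rewrite /ad !mulrA; ring.
pose F b m := (frac g (d b) 0 - E (g ^+ m) (frac g b m)) * frac g 1 m.
have Fexp k b m : F (g ^+ k * b) (k + m)%N = F b m.
  rewrite /F frac_expand exprD Emul frac_cancel EE.
  have -> : frac g (ad d (g ^+ k) b) 0
          = frac g (d (g ^+ k * b)) 0 - frac g (g ^+ k) 0 * frac g (d b) 0.
    by rewrite fracM fracN fracDl.
  have -> : frac g 1 (k + m) = frac g 1 k * frac g 1 m by rewrite fracM mulr1.
  by rewrite -[RHS]mul1r -(frac_unit g k); ring.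
have Fwd b m c p : frac g b m = frac g c p -> F b m = F c p.
  move=> /eq_frac[k e]; rewrite -(Fexp (k + p)%N b) -(Fexp (k + m)%N c).
  rewrite !exprD -!mulrA e; congr F; lia.
pose d' (x : loc g) := F (repr x).1 (repr x).2.
have d'E b m : d' (frac g b m) = F b m by apply: Fwd; rewrite fracP.
have d'0 b : d' (frac g b 0) = frac g (d b) 0.
  rewrite d'E /F EE /ad expr0 !mul1r subrr frac0 subr0; exact: mulr1.
have FA b c m : F (b + c) m = F b m + F c m.
  by rewrite /F dA -!fracDl EA; ring.
have d'A x y : d' (x + y) = d' x + d' y.
  elim/locW: x => b m; elim/locW: y => c p.
  rewrite fracD d'E FA (addnC m p) Fexp (addnC p m) Fexp !d'E.
  by [].
have d'l : linear d'.
  move=> k x y; rewrite d'A; congr (_ + _); elim/locW: x => b m.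
  rewrite fracZ !d'E /F -fracZ EZ.
  have -> : d (k *: b) = k *: d b.
    have d0 : d 0 = 0 by apply: (@addrI _ (d 0)); rewrite -dA !addr0.
    by have := dl k b 0; rewrite addr0 d0 addr0.
  by rewrite -fracZ -scalerBr ![_ * frac g 1 m]mulrC loc_scalerAr.
exists d'; split=> //.
have adE c x : ad d' (frac g c 0) x = E c x.
  elim/locW: x => b m; apply: (@frac_mulI _ _ m).
  have := Emul (g ^+ m) c (frac g b m).
  rewrite mulrC Emul frac_cancel EE fracM add0n => eq1.
  have {eq1} -> : frac g (g ^+ m) 0 * E c (frac g b m) =
     frac g (ad d c b) 0 + frac g c 0 * E (g ^+ m) (frac g b m) - E (g ^+ m) (frac g (c * b) m).
    by rewrite eq1; ring.
  have -> : frac g (ad d c b) 0 = frac g (d (c * b)) 0 - frac g c 0 * frac g (d b) 0.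
    by rewrite fracM fracN fracDl.
  rewrite /ad (fracM _ c 0 b m) add0n !d'E /F.
  transitivity ((frac g (g ^+ m) 0 * frac g 1 m) * 
    (frac g (d (c * b)) 0 - E (g ^+ m) (frac g (c * b) m)
      - frac g c 0 * (frac g (d b) 0 - E (g ^+ m) (frac g b m)))); first ring.
  by rewrite frac_unit; ring.
elim/locW=> c m.
apply: (@eq_diff_order _ _ (fun x => E c (frac g 1 m * x)
     + frac g c 0 * - (frac g 1 m * E (g ^+ m) (frac g 1 m * x)))).
  move=> x; rewrite -!adE /ad (frac_split g c m).
  have e1 : frac g (g ^+ m) 0 * (frac g 1 m * x) = x by rewrite mulrA frac_unit mul1r.
  rewrite e1 -[frac g c 0 * frac g 1 m * x]mulrA.
  transitivity (d' (frac g c 0 * (frac g 1 m * x)) - frac g c 0 * frac g 1 m * d' x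
    - (1 - frac g (g ^+ m) 0 * frac g 1 m) * (frac g c 0 * d' (frac g 1 m * x))); last first.
    by rewrite frac_unit; ring.
  by ring.
apply: diff_orderD; first by apply: diff_order_rmul.
apply: diff_order_lmul; apply: diff_orderN; apply: diff_order_lmul.
by apply: (@diff_order_rmul _ _ (E (g ^+ m))).
Qed.

Lemma loc_ext_exist_uniq (d : diffop B) : exists! d', loc_extends d d'.
Proof.
have [n dn] := diffop_order d.
have [d' [d'l d'n d'E]] := loc_ext_exists (diffop_linear d) dn.
exists d'; split; first by split=> //; exists n.
move=> e [_ [m em] eE]; apply: funext; apply: (loc_ext_eq d'n em) => b.
by rewrite d'E eE.
Qed.

(* The action of D_{B|K} on the localization by the unique extension. *)
Definition loc_act (d : diffop B) : loc g -> loc g :=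
  sval (cid (loc_ext_exist_uniq d)).

Lemma loc_actP (d : diffop B) : loc_extends d (loc_act d).
Proof. by rewrite /loc_act; case: cid => d' []. Qed.

End LocAlg.

(* For h additive with h (g^n b) = g'^n h b, this is the induced map
   b / g^n |-> h b / g'^n; see [loc_mapE]. *)
Section LocMap.
Variables (B C : comNzRingType) (g : B) (g' : C) (h : B -> C).
Hypothesis hM : forall n b, h (g ^+ n * b) = g' ^+ n * h b.

Definition loc_map (x : loc g) : loc g' := frac g' (h (repr x).1) (repr x).2.

Lemma loc_mapE b n : loc_map (frac g b n) = frac g' (h b) n.
Proof.
have [k e] := repr_frac g b n.
by apply/eq_frac; exists k; rewrite -!hM e.
Qed.

Lemma loc_mapD : (forall b c, h (b + c) = h b + h c) ->
  forall x y, loc_map (x + y) = loc_map x + loc_map y.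
Proof.
move=> hD x y; elim/locW: x => b n; elim/locW: y => c m.
by rewrite fracD !loc_mapE hD !hM fracD.
Qed.
End LocMap.

Section Coefficients.
Variables (l : nat) (G H : zmodType).
Implicit Types (t : 'I_l -> int) (p : {malg G['X_{1..l}]}).

(* A polynomial in s_1, ..., s_l with coefficients in G is an element of
   [{malg G['X_{1..l}]}]. This is its value at an integer point t; it serves
   both for polynomials over a localization, where the value is h(t), and for
   polynomials over the ring of differential operators, where it is delta(t). *)
Definition eval_int t p : G :=
  \sum_(m <- msupp p) p@_m *~ (\prod_(i < l) t i ^+ m i).

Definition map_coef (h : G -> H) p : {malg H['X_{1..l}]} :=
  [malg m in msupp p => h p@_m].

Lemma map_coefE h p m : h 0 = 0 -> (map_coef h p)@_m = h p@_m.
Proof.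
move=> h0; rewrite mcoeffE; case: ifP => // /negbT.
by rewrite -mcoeff_eq0 => /eqP->.
Qed.
End Coefficients.

Section SpecializationModule.
Variables (K : fieldType) (B : comAlgType K) (l : nat) (f : 'I_l -> B).

Definition fs_loc := loc (\prod_(i < l) f i).

(* M^B[f^s]: the polynomial h(s) with coefficients in B_{f_1...f_l} stands for
   the element h(s) f_1^{s_1} ... f_l^{s_l}. The type [malg] is used since it
   only needs a zmodType of coefficients. *)
Definition fs_module := {malg fs_loc['X_{1..l}]}.

(* The inverse of f_i in the localization. *)
Definition fs_inv (i : 'I_l) : fs_loc := frac _ (\prod_(j < l | j != i) f j) 1.

Lemma fs_invP i : frac _ (f i) 0 * fs_inv i = 1.
Proof.
rewrite /fs_inv -(frac_unit _ 1) !fracM expr1 mulr1.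
by congr frac; rewrite [RHS](bigD1 i).
Qed.

Definition fs_pow (i : 'I_l) (z : int) : fs_loc :=
  match z with
  | Posz n => frac _ (f i) 0 ^+ n
  | Negz n => fs_inv i ^+ n.+1
  end.

(* phi_t : h(s) f^s |-> h(t) f^t. *)
Definition specialize (t : 'I_l -> int) (v : fs_module) : fs_loc :=
  eval_int t v * \prod_(i < l) fs_pow i (t i).

Definition fs_scale (b : B) (v : fs_module) : fs_module :=
  map_coef (fun x => frac _ b 0 * x) v.

Lemma fs_scaleE b v m : (fs_scale b v)@_m = frac _ b 0 * v@_m.
Proof. by apply: map_coefE; rewrite mulr0. Qed.

Definition compatible_with_specialization
    (act : {malg (diffop B)['X_{1..l}]} -> fs_module -> fs_module) : Prop :=
  forall delta v t,
    specialize t (act delta v) = loc_act (eval_int t delta) (specialize t v).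
End SpecializationModule.

(* A left R-module structure on a given abelian group: the axioms of
   [GRing.Zmodule_isLmodule]. *)
Record module_action (R : pzRingType) (V : zmodType) (act : R -> V -> V) : Prop :=
  ModuleAction {
    action1 : left_id 1 act;
    actionA : forall a b v, act a (act b v) = act (a * b) v;
    actionDr : right_distributive act +%R;
    actionDl : forall v, {morph act^~ v : a b / a + b}
  }.

Section DirectSummand.
Variables (K : fieldType) (A T : comAlgType K) (iota : {lrmorphism A -> T}).

(* A-linear splittings beta : T -> A of the inclusion iota of A in T. *)
Record splitting := Splitting {
  split_fun :> T -> A;
  splitD : {morph split_fun : x y / x + y};
  splitM : forall a x, split_fun (iota a * x) = a * split_fun x;
  splitK : cancel iota split_fun
}.

Variable beta : splitting.

Lemma split_linear : linear beta.
Proof.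
move=> k x y; rewrite splitD.
have -> : k *: x = iota k%:A * x by rewrite linearZ /= rmorph1 -scalerAl mul1r.
by rewrite splitM -scalerAl mul1r.
Qed.

Lemma is_diffop_restrict (d : diffop T) : (fun a => beta (d (iota a))) \in @is_diffop K A.
Proof.
apply/asboolP; split.
  by move=> k x y; rewrite linearP diffop_linear split_linear.
have [n dn] := diffop_order d; exists n.
have bB x y : beta (x - y) = beta x - beta y.
  exact: (GRing.zmod_morphism_linear split_linear).
elim: n (d : T -> T) dn => [|n IH] e /= eP b.
  by move=> x; rewrite rmorphM eP splitM.
apply: eq_diff_order (IH _ (eP (iota b))) => x.
by rewrite /ad bB splitM rmorphM.
Qed.

(* beta o d|_A *)
Definition restrict (d : diffop T) : diffop A := Diffop (is_diffop_restrict d).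

Section DifferentialSplitting.
Variables (l : nat) (M N : zmodType).
Variables (actM : {malg (diffop A)['X_{1..l}]} -> M -> M)
          (actN : {malg (diffop T)['X_{1..l}]} -> N -> N).

(* M is a differential direct summand of N along the inclusion incl, with
   differential splitting Theta. The A-module structures on M and N are those
   induced by A in D_{A|K}[s] and by A in T in D_{T|K}[s]. *)
Record differential_splitting (incl : M -> N) (Theta : N -> M) : Prop :=
  DifferentialSplitting {
    incl_inj : injective incl;
    inclD : {morph incl : v w / v + w};
    inclZ : forall a v,
      incl (actM (mul_diffop a)%:MP v) = actN (mul_diffop (iota a))%:MP (incl v);
    ThetaD : {morph Theta : v w / v + w};
    ThetaZ : forall a w,
      Theta (actN (mul_diffop (iota a))%:MP w) = actM (mul_diffop a)%:MP (Theta w);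
    ThetaK : cancel incl Theta;
    Theta_act : forall delta v,
      Theta (actN delta (incl v)) = actM (map_coef restrict delta) v
  }.
End DifferentialSplitting.

Section FsModules.
Variables (l : nat) (f : 'I_l -> A).

Definition fs_incl : fs_module f -> fs_module (iota \o f) :=
  map_coef (loc_map _ iota).

(* M^A[f^s] (x)_A beta, where v (x) x in M^A[f^s] (x)_A T is identified with
   x v in M^T[f^s]. It is the additive map with the value beta(x) v at x v
   ([fs_tensor_split_pure]); the x v span M^T[f^s] ([fs_tensor_span]). *)
Definition fs_tensor_split : fs_module (iota \o f) -> fs_module f :=
  map_coef (loc_map _ beta).

Lemma iota_prodX n a :
  iota ((\prod_(i < l) f i) ^+ n * a) = (\prod_(i < l) (iota \o f) i) ^+ n * iota a.
Proof. by rewrite rmorphM rmorphXn rmorph_prod. Qed.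

Lemma split_prodX n x :
  beta ((\prod_(i < l) (iota \o f) i) ^+ n * x) = (\prod_(i < l) f i) ^+ n * beta x.
Proof. by rewrite -[in RHS]splitM rmorphXn rmorph_prod. Qed.

Lemma loc_map0 (B C : comNzRingType) (g : B) (g' : C) (h : B -> C) :
  (forall n b, h (g ^+ n * b) = g' ^+ n * h b) -> h 0 = 0 -> loc_map g' h (0 : loc g) = 0.
Proof. by move=> hM h0; rewrite -(frac0 g 0) loc_mapE // h0 frac0. Qed.

Lemma split0 : beta 0 = 0.
Proof. by rewrite -(mulr0 (iota 0)) splitM mul0r. Qed.

Lemma fs_inclE v m : (fs_incl v)@_m = loc_map _ iota v@_m.
Proof.
by apply: map_coefE; apply: loc_map0; [apply: iota_prodX | apply: rmorph0].
Qed.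

Lemma fs_tensor_splitE w m : (fs_tensor_split w)@_m = loc_map _ beta w@_m.
Proof.
by apply: map_coefE; apply: loc_map0; [apply: split_prodX | apply: split0].
Qed.

Lemma fs_tensor_splitD : {morph fs_tensor_split : v w / v + w}.
Proof.
move=> v w; apply/malgP => m; rewrite mcoeffD !fs_tensor_splitE mcoeffD.
by apply: loc_mapD; [apply: split_prodX | apply: splitD].
Qed.

Lemma fs_tensor_split_pure v x :
  fs_tensor_split (fs_scale x (fs_incl v)) = fs_scale (beta x) v.
Proof.
apply/malgP => m; rewrite fs_tensor_splitE !fs_scaleE fs_inclE.
elim/locW: (v@_m) => a n; rewrite loc_mapE; last exact: iota_prodX.
rewrite !fracM loc_mapE; last exact: split_prodX.
by rewrite (mulrC x) splitM (mulrC a).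
Qed.

Lemma fs_tensor_span w : exists (r : nat) (x : 'I_r -> T) (v : 'I_r -> fs_module f),
  w = \sum_(i < r) fs_scale (x i) (fs_incl (v i)).
Proof.
pose num m := (repr w@_m).1; pose den m := (repr w@_m).2.
pose s : seq _ := msupp w.
exists (size s), (fun i => num (tnth (in_tuple s) i)),
  (fun i => << frac _ 1 (den (tnth (in_tuple s) i)) *g tnth (in_tuple s) i >>).
rewrite [LHS]monalgE -(big_tuple _ _ (in_tuple s) xpredT
  (fun m => fs_scale (num m) (fs_incl << frac _ 1 (den m) *g m >>))).
apply: eq_bigr => m _; apply/malgP => m'.
rewrite fs_scaleE fs_inclE !mcoeffU.
case: eqP => [->|_] /=.
  rewrite !mulr1n loc_mapE; last exact: iota_prodX.
  by rewrite rmorph1 fracM mulr1 fracP.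
rewrite !mulr0n loc_map0 ?mulr0 //; [exact: iota_prodX | exact: rmorph0].
Qed.

End FsModules.
End DirectSummand.

(* Main.v *)
(** Since [K] has characteristic zero, an element of [M^A[f^s]] is determined by
    its specializations at all integer points [t], so the identities of a
    differential splitting may be checked after specialization.  There, [Theta]
    becomes the localization [beta_f] of [beta], because the [f_i^{t_i}] lie in
    the localization of [A], and the claim reduces to
    [beta_f o d_f o iota_f = (beta o d o iota)_f] for a differential operator [d]
    of [T]; this holds as both sides are differential operators on [A_f]
    extending [beta o d o iota]. *)

Require Import Defs.
From HB Require Import structures.
From mathcomp Require Import all_boot all_order all_algebra.
From mathcomp Require Import finmap monalg.

Set Implicit Arguments.
Unset Strict Implicit.
Unset Printing Implicit Defensive.

Import GRing.Theory Num.Theory.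

Local Open Scope ring_scope.

(** * Evaluation at integer points *)

Section EvalInt.
Variables (l : nat) (G : zmodType).
Implicit Types (t : 'I_l -> int) (p q : {malg G['X_{1..l}]}).

(** Lets polynomials with different supports be summed over one index set. *)
Lemma eval_intEw t (d : {fset 'X_{1..l}}) p : (msupp p `<=` d)%fset ->
  eval_int t p = \sum_(m <- d) p@_m *~ (\prod_(i < l) t i ^+ m i).
Proof.
move=> sub; rewrite /eval_int; apply: big_fset_incl => // m _.
by rewrite -mcoeff_eq0 => /eqP->; rewrite mul0rz.
Qed.

Lemma eval_intB t : {morph @eval_int l G t : p q / p - q}.
Proof.
move=> p q; pose d := (msupp p `|` msupp q)%fset.
rewrite (@eval_intEw t d (p - q)) ?msuppB_le //.
rewrite (@eval_intEw t d p) ?fsubsetUl // (@eval_intEw t d q) ?fsubsetUr //.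
by rewrite -sumrB; apply: eq_bigr => m _; rewrite mcoeffB mulrzBl.
Qed.

Lemma eval_intC t (c : G) : eval_int t (c%:MP : {malg G['X_{1..l}]}) = c.
Proof.
rewrite (@eval_intEw t [fset mone : 'X_{1..l}]%fset) ?msuppC_le //.
rewrite big_seq_fset1 mcoeffUU.
by rewrite big1 ?mulr1z // => i _; rewrite cm1 expr0.
Qed.

End EvalInt.

Lemma morphD_morphB (G H : zmodType) (h : G -> H) :
  {morph h : x y / x + y} -> {morph h : x y / x - y}.
Proof. by move=> hD x y; apply: (addIr (h y)); rewrite -hD !subrK. Qed.

Lemma eval_int_map l (G H : zmodType) (h : G -> H) t (p : {malg G['X_{1..l}]}) :
  {morph h : x y / x + y} -> eval_int t (map_coef h p) = h (eval_int t p).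
Proof.
move=> /morphD_morphB hB; pose ha : {additive G -> H} :=
  HB.pack h (GRing.isZmodMorphism.Build G H h hB).
have h0 : h 0 = 0 := raddf0 ha.
(* [h] may kill coefficients, so the support can shrink; both sums are taken over [msupp p]. *)
rewrite (@eval_intEw _ _ t (msupp p) (map_coef h p)); last first.
  apply/fsubsetP => m; rewrite -!mcoeff_neq0 map_coefE //.
  by apply: contraNneq => ->; rewrite h0.
rewrite /eval_int -[RHS]/(ha _) raddf_sum; apply: eq_bigr => m _.
by rewrite map_coefE // raddfMz.
Qed.

(** * Distinct primes and unique factorization *)

Definition next_prime (n : nat) : nat := pdiv (n`!).+1.

Lemma prime_next n : prime (next_prime n).
Proof. by rewrite pdiv_prime // ltnS fact_gt0. Qed.

(** Euclid's argument: a prime factor of n! + 1 that is at most n would also divide n!, hence 1. *)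
Lemma ltn_next_prime n : (n < next_prime n)%N.
Proof.
rewrite ltnNge; apply/negP => le.
have := pdiv_dvd (n`!).+1; rewrite -addn1 dvdn_addr.
  by rewrite dvdn1 => /eqP p1; have := prime_next n; rewrite /next_prime -addn1 p1.
by rewrite addn1 dvdn_fact // le pdiv_gt0.
Qed.

Lemma exists_primes : exists2 p : nat -> nat,
  injective p & forall i, prime (p i).
Proof.
exists (fun i => iter i.+1 next_prime 0); last by move=> i; apply: prime_next.
apply: incn_inj; apply: leq_mono; apply: homo_ltn => [y x z|i].
  exact: ltn_trans.
exact: ltn_next_prime.
Qed.

(** The [p i]-adic valuation of the product recovers the exponent [m i]. *)
Lemma prod_prime_pow_inj l (p : 'I_l -> nat) (m m' : 'I_l -> nat) :
  injective p -> (forall i, prime (p i)) ->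
  (\prod_(i < l) p i ^ m i = \prod_(i < l) p i ^ m' i)%N -> m =1 m'.
Proof.
move=> pI pP e i.
have logE (n : 'I_l -> nat) : logn (p i) (\prod_(j < l) p j ^ n j)%N = n i.
  have p0 j : (0 < p j ^ n j)%N by rewrite expn_gt0 prime_gt0.
  rewrite (bigD1 i) //= lognM ?prodn_cond_gt0 //.
  rewrite pfactorK // logn_coprime ?addn0 //.
  apply: (big_ind (fun x => coprime (p i) x)) => [|x y|j ji].
  - exact: coprimen1.
  - by rewrite coprimeMr => -> ->.
  - apply: coprimeXr; rewrite prime_coprime // dvdn_prime2 //.
    by apply: contra ji => /eqP /pI ->.
by rewrite -(logE m) e logE.
Qed.

(** * Polynomials vanishing at all integer points *)

Section Vanishing.
Variables (K : fieldType) (charK : [pchar K] =i pred0).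

(** Characteristic zero enters here: a nonzero integer stays nonzero in [K], so it acts injectively
    on [V]. *)
Lemma mulrz_eq0 (V : lmodType K) (v : V) (z : int) :
  z != 0 -> v *~ z = 0 -> v = 0.
Proof.
move=> z0; rewrite -scaler_int => /eqP; rewrite scaler_eq0 => /orP[|/eqP//].
have natK n : (n.+1%:R == 0 :> K) = false by have /pcharf0P -> := charK.
case: z z0 => [[|n]|n] //= _; first by rewrite natK.
by rewrite NegzE mulrNz oppr_eq0 natK.
Qed.

(* Evaluating at t = (q_1^j, ..., q_l^j) for distinct primes q_i sends the
   monomials to the j-th powers of distinct integers c_m. Linear combinations
   over j give [\sum_m p_m P(c_m) = 0] for every polynomial P over the integers,
   and P can be chosen to vanish at all c_m but one. *)
Lemma eval_int_eq0 (V : lmodType K) l (p : {malg V['X_{1..l}]}) :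
  (forall t, eval_int t p = 0) -> p = 0.
Proof.
move=> p0; have [q qI qP] := exists_primes.
pose c (m : 'X_{1..l}) : int := \prod_(i < l) (q i)%:Z ^+ m i.
have cI : injective c.
  move=> m m' e; apply/eqP/cmP; apply: (@prod_prime_pow_inj l q) => //.
    by move=> i j /qI /val_inj.
  have absE (m0 : 'X_{1..l}) : absz (c m0) = (\prod_(i < l) q i ^ m0 i)%N.
    rewrite (big_morph absz abszM (erefl : absz 1 = 1%N)).
    by apply: eq_bigr => i _; rewrite abszX.
  by rewrite -!absE e.
have sumX j : \sum_(m <- msupp p) p@_m *~ (c m ^+ j) = 0.
  rewrite -[RHS](p0 (fun i => (q i)%:Z ^+ j)); apply: eq_bigr => m _.
  congr (_ *~ _); rewrite -prodrXl; apply: eq_bigr => i _.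
  by rewrite exprAC.
have sumP (P : {poly int}) : \sum_(m <- msupp p) p@_m *~ P.[c m] = 0.
  transitivity (\sum_(m <- msupp p) \sum_(j < size P) (p@_m *~ (c m ^+ j)) *~ P`_j).
    apply: eq_bigr => m _; rewrite horner_coef mulrz_sumr.
    by apply: eq_bigr => j _; rewrite mulrC mulrzA.
  rewrite exchange_big big1 // => j _.
  by rewrite -mulrz_suml sumX mul0rz.
apply/malgP => m; rewrite mcoeff0; apply/eqP.
rewrite mcoeff_eq0; apply/negP => mp.
have [P [Pm Pm']] : exists P : {poly int}, P.[c m] != 0 /\
    forall m', m' \in msupp p -> m' != m -> P.[c m'] = 0.
  exists (\prod_(m' <- msupp p | m' != m) ('X - (c m')%:P)).
  rewrite horner_prod; split.
    rewrite prodf_seq_neq0; apply/allP => m' _; apply/implyP => m'm.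
    by rewrite hornerXsubC subr_eq0 (inj_eq cI) eq_sym.
  move=> m' m'p m'm; apply/eqP; rewrite horner_prod prodf_seq_eq0.
  by apply/hasP; exists m' => //; rewrite m'm hornerXsubC subrr eqxx.
have := sumP P; rewrite (bigD1_seq m) ?fset_uniq // big_seq_cond.
rewrite big1 => [|m' /andP[m'p m'm]]; last by rewrite Pm' // mulr0z.
rewrite /= addr0 => /(mulrz_eq0 Pm) pm0.
by move: mp; rewrite -mcoeff_neq0 pm0 eqxx.
Qed.
End Vanishing.

(** * Specializations determine an element *)

Section SpecializeInj.
Variables (K : fieldType) (B : comAlgType K) (l : nat) (f : 'I_l -> B).

(** Cancelling this unit recovers h(t) from the specialization h(t) f^t. *)
Lemma fs_pow_unit (t : 'I_l -> int) :
  exists y, (\prod_(i < l) fs_pow f i (t i)) * y = 1.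
Proof.
apply: (big_ind (fun x => exists y, x * y = 1)) => [|x x' [y e] [y' e']|i _].
- by exists 1; rewrite mulr1.
- by exists (y * y'); rewrite mulrACA e e' mulr1.
- case: (t i) => n /=.
    by exists (fs_inv f i ^+ n); rewrite -exprMn fs_invP expr1n.
  by exists (Defs.frac _ (f i) 0 ^+ n.+1); rewrite -exprMn mulrC fs_invP expr1n.
Qed.

Lemma specialize_inj (charK : [pchar K] =i pred0) (v w : fs_module f) :
  (forall t, specialize t v = specialize t w) -> v = w.
Proof.
move=> e; apply/eqP; rewrite -subr_eq0; apply/eqP.
apply: (@eval_int_eq0 K charK (fs_loc f)) => t.
rewrite eval_intB; have [y yP] := fs_pow_unit t.
have := congr1 ( *%R^~ y) (e t); rewrite /specialize -!mulrA yP !mulr1 => ->.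
exact: subrr.
Qed.
End SpecializeInj.

(** * Operators on the localization *)

Section LocAct.
Variables (K : fieldType) (B : comAlgType K) (g : B).

(** Any linear map of finite order that extends [d] can thus be used to compute [loc_act d]. *)
Lemma loc_act_uniq (d : diffop B) (d' : loc g -> loc g) :
  loc_extends d d' -> loc_act d =1 d'.
Proof.
have [d0 [_ uniq]] := loc_ext_exist_uniq g d.
by move=> /uniq <- x; rewrite (uniq _ (loc_actP g d)).
Qed.

Lemma loc_act_mul (b : B) (x : loc g) : loc_act (mul_diffop b) x = Defs.frac g b 0 * x.
Proof.
move: x; apply: loc_act_uniq; split.
- by move=> k x y; rewrite mulrDr loc_scalerAr.
- by exists 0%N => c x; rewrite mulrCA.
- by move=> c; rewrite fracM.
Qed.
End LocAct.

(** * Localized inclusion and splitting *)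

Section Splitting.
Variables (K : fieldType) (A T : comAlgType K) (iota : {lrmorphism A -> T}).
Variables (beta : splitting iota) (l : nat) (f : 'I_l -> A).

Let iotaM := iota_prodX iota f.
Let betaM := split_prodX beta f.

Local Notation floc := (fs_loc f).
Local Notation Tloc := (fs_loc (iota \o f)).
Local Notation iotaf := (loc_map _ iota : floc -> Tloc).
Local Notation betaf := (loc_map _ beta : Tloc -> floc).

Lemma loc_iotaD : {morph iotaf : x y / x + y}.
Proof. by move=> x y; apply: loc_mapD => //; apply: rmorphD. Qed.

Lemma loc_splitD : {morph betaf : x y / x + y}.
Proof. by move=> x y; apply: loc_mapD => //; apply: splitD. Qed.

Lemma loc_iotaM : {morph iotaf : x y / x * y}.
Proof.
move=> x y; elim/locW: x => a n; elim/locW: y => b m.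
by rewrite fracM !loc_mapE // rmorphM fracM.
Qed.

Lemma loc_iota1 : iotaf 1 = 1.
Proof. by rewrite -!frac1 loc_mapE // rmorph1. Qed.

Lemma loc_splitM x y : betaf (iotaf x * y) = x * betaf y.
Proof.
elim/locW: x => a n; elim/locW: y => b m.
by rewrite loc_mapE // fracM !loc_mapE // splitM fracM.
Qed.

Lemma loc_splitK : cancel iotaf betaf.
Proof. by move=> x; elim/locW: x => a n; rewrite !loc_mapE // Defs.splitK. Qed.

Lemma loc_iotaZ k x : iotaf (k *: x) = k *: iotaf x.
Proof. by elim/locW: x => a n; rewrite fracZ !loc_mapE // linearZ fracZ. Qed.

Lemma loc_splitZ k y : betaf (k *: y) = k *: betaf y.
Proof.
elim/locW: y => b n; rewrite fracZ !loc_mapE // fracZ; congr Defs.frac.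
by have := split_linear beta k b 0; rewrite !addr0 split0 addr0.
Qed.

Lemma fs_pow_iota (t : 'I_l -> int) :
  iotaf (\prod_(i < l) fs_pow f i (t i))
  = \prod_(i < l) fs_pow (iota \o f) i (t i).
Proof.
rewrite (big_morph _ loc_iotaM loc_iota1); apply: eq_bigr => i _.
have iotaX x n : iotaf (x ^+ n) = iotaf x ^+ n.
  by elim: n => [|n IH]; rewrite ?expr0 ?loc_iota1 // !exprS loc_iotaM IH.
case: (t i) => n; rewrite /fs_pow iotaX loc_mapE //.
(* What remains is the negative exponents: the numerator of [fs_inv] is the product of the other
   f_j, which [iota] preserves. *)
by rewrite rmorph_prod.
Qed.

Lemma specialize_incl t (v : fs_module f) :
  specialize t (fs_incl iota v) = iotaf (specialize t v).
Proof.
by rewrite /specialize loc_iotaM fs_pow_iota /fs_incl (eval_int_map _ _ loc_iotaD).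
Qed.

(** The factor f^t is the image of an element of the localization of [A], over which the localized
    splitting is linear. *)
Lemma specialize_split t (w : fs_module (iota \o f)) :
  specialize t (fs_tensor_split beta w) = betaf (specialize t w).
Proof.
rewrite /specialize -fs_pow_iota mulrC [in RHS]mulrC loc_splitM.
by rewrite /fs_tensor_split (eval_int_map _ _ loc_splitD).
Qed.

Lemma loc_act_restrict (d : diffop T) x :
  loc_act (restrict beta d) x = betaf (loc_act d (iotaf x)).
Proof.
have [dl [n dn] dE] := loc_actP (\prod_(i < l) (iota \o f) i) d.
move: x; apply: loc_act_uniq.
split; last by move=> b; rewrite loc_mapE // dE loc_mapE.
  by move=> k x y; rewrite loc_iotaD loc_iotaZ dl loc_splitD loc_splitZ.
(* The operator is generalized to any [e] because the commutator of the composite with [b] is again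
   such a composite, built from the commutator of [e] with the image of [b]. *)
exists n; elim: n (loc_act d) dn {dl dE} => [|n IH] e /= eP b.
  by move=> x; rewrite loc_iotaM eP loc_splitM.
apply: eq_diff_order (IH _ (eP (iotaf b))) => x.
by rewrite /ad (morphD_morphB loc_splitD) loc_splitM loc_iotaM.
Qed.

Lemma restrictD : {morph restrict beta : d e / d + e}.
Proof. by move=> d e; apply: diffop_eq => x; apply: splitD. Qed.

Lemma fs_inclD : {morph fs_incl iota (f:=f) : v w / v + w}.
Proof.
move=> v w; apply/malgP => m; rewrite mcoeffD !fs_inclE mcoeffD.
exact: loc_iotaD.
Qed.

Lemma fs_tensor_splitK : cancel (fs_incl iota (f:=f)) (fs_tensor_split beta (f:=f)).
Proof.
by move=> v; apply/malgP => m; rewrite fs_tensor_splitE fs_inclE loc_splitK.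
Qed.
End Splitting.

Theorem theorem3p21 (K : fieldType) (charK : [pchar K] =i pred0)
    (A T : comAlgType K)
    (iota : {lrmorphism A -> T}) (iota_inj : injective iota)
    (noethA : noetherian A) (noethT : noetherian T)
    (beta : splitting iota)
    (l : nat) (f : 'I_l -> A)
    (actA : {malg (diffop A)['X_{1..l}]} -> fs_module f -> fs_module f)
    (actT : {malg (diffop T)['X_{1..l}]} ->
            fs_module (iota \o f) -> fs_module (iota \o f))
    (modA : module_action actA) (modT : module_action actT)
    (specA : compatible_with_specialization actA)
    (specT : compatible_with_specialization actT) :
  differential_splitting beta actA actT
    (fs_incl iota (f:=f)) (fs_tensor_split beta (f:=f)).
Proof.
have iotaM := iota_prodX iota f.
split.
- exact: can_inj (fs_tensor_splitK beta (f:=f)).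
- exact: fs_inclD.
(* [a] acts through a constant polynomial, which specializes at every t to multiplication by [a]. *)
- move=> a v; apply: (specialize_inj charK) => t.
  rewrite specialize_incl specA specT !eval_intC !loc_act_mul loc_iotaM.
  by rewrite specialize_incl loc_mapE.
- exact: fs_tensor_splitD.
- move=> a w; apply: (specialize_inj charK) => t.
  rewrite specialize_split specA specT !eval_intC !loc_act_mul.
  by rewrite specialize_split -loc_splitM loc_mapE.
- exact: fs_tensor_splitK.
- move=> d v; apply: (specialize_inj charK) => t.
  rewrite specialize_split specA specT specialize_incl.
  (* Restriction of operators is additive, so it commutes with evaluating [d] at t. *)
  by rewrite (eval_int_map _ _ (restrictD beta)) loc_act_restrict.
Qed.
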